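(* Let $C=(1,c_2,c_3,c_4,c_5,c_6)$ be a canonical system whose subsystem $C'=(1,c_2,c_3,c_4,c_5)$ is noncanonical, and let $\ell=\lceil c_5/c_3\rceil$. Then $C$ satisfies (a), (b), or (c): (a) $C=(1,2,3,c_4,c_4+1,2c_4)$ and $c_4>4$; (b) $C=(1,c_2,2c_2-1,c_4,c_2+c_4-1,2c_4-1)$, $c_4\ge 3c_2-1$, $\mathrm{grd}_C(\ell c_3)=\ell c_3-c_5+1-\lfloor(\ell c_3-c_5)/c_2\rfloor(c_2-1)$, and $\mathrm{grd}_C(\ell c_3)\le\ell$; (c) $C=(1,c_2,2c_2,c_4,c_2+c_4,2c_4)$, $c_4\ge 3c_2-1$, $c_4\ne 3c_2$, $\mathrm{grd}_C(\ell c_3)=\ell c_3-c_5+1-\lfloor(\ell c_3-c_5)/c_2\rfloor(c_2-1)$, and $\mathrm{grd}_C(\ell c_3)\le\ell$.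
   Context: A system is a tuple $C=(c_1,\dots,c_n)$ of integers with $1=c_1<c_2<\dots<c_n$; for $k\le n$, $(c_1,\dots,c_k)$ is a subsystem. For a positive integer $v$, $\mathrm{opt}_C(v)$ is the minimum of $\sum_i x_i$ over $x\in\mathbb{Z}_{\ge0}^n$ with $\sum_i c_ix_i=v$. The greedy representation of $v$ is produced by: for $i=n$ down to $1$, while $c_i\le$ remaining value, take a coin $c_i$. $\mathrm{grd}_C(v)$ is its number of coins. A positive integer $w$ is a counterexample if $\mathrm{opt}_C(w)<\mathrm{grd}_C(w)$; $C$ is canonical if it has none, noncanonical otherwise. *)

(* Defs.v *)
From mathcomp Require Import all_boot.
Set Implicit Arguments. Unset Strict Implicit. Unset Printing Implicit Defensive.

Definition is_system (C : seq nat) : bool :=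
  (head 0 C == 1) && sorted ltn C.

Definition coin_value (C x : seq nat) : nat :=
  \sum_(i < size C) nth 0 C i * nth 0 x i.

Definition represents (C x : seq nat) (v : nat) : Prop :=
  size x = size C /\ coin_value C x = v.

Definition opt_le (C : seq nat) (v k : nat) : Prop :=
  exists x, represents C x v /\ sumn x <= k.

Definition is_opt (C : seq nat) (v k : nat) : Prop :=
  opt_le C v k /\ forall x, represents C x v -> k <= sumn x.

(* greedy on coins listed in decreasing order: take v %/ c coins of c
   (i.e. "while c <= remaining, take c"), continue with the remainder *)
Fixpoint grd_dec (cs : seq nat) (v : nat) : nat :=
  match cs with
  | [::] => 0
  | c :: cs' => v %/ c + grd_dec cs' (v %% c)
  end.

Definition grd (C : seq nat) (v : nat) : nat := grd_dec (rev C) v.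

Definition counterexample (C : seq nat) (w : nat) : Prop :=
  0 < w /\ exists k, is_opt C w k /\ k < grd C w.

Definition canonical (C : seq nat) : Prop := forall w, ~ counterexample C w.

(* Main.v *)
Require Import Defs.
From mathcomp Require Import all_boot.
From mathcomp Require Import zify.
From Stdlib Require Import Classical.

(** Let [w] be the least counterexample of [C'] and fix a change of [w] beating greedy. Since
    [C] is canonical, [c6 <= w]. By minimality every coin [d] of the change satisfies
    [w < d + c5], and the remaining coins may be replaced by the greedy change of [w - d].
    Hence [c6 < c4 + c5], so greedy on [c4 + c5] and [2 * c5] takes [c6] first and must finish
    with one coin: [c4 + c5 = c6 + cj] and [2 * c5 = c6 + ci]. Together with the sums [c2 + c5]
    and [c3 + c5] this forces [w = 2 * c4 = c6 + cp] with [cp] zero or a coin. Solving for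
    [c4, c5, c6] leaves the three families, and a few more two-coin sums give the
    inequalities on [c4]. *)

Set Implicit Arguments. Unset Strict Implicit. Unset Printing Implicit Defensive.

(** * Greedy change, one coin at a time *)

Definition largest_coin (C : seq nat) (v t : nat) : Prop :=
  [/\ t \in C, t <= v & forall c, c \in C -> c <= v -> c <= t].

Lemma largest_coin_ex C v c :
  c \in C -> c <= v -> exists t, largest_coin C v t.
Proof.
move=> cC cv; have ex : exists t, (t \in C) && (t <= v) by exists c; apply/andP.
have bd t : (t \in C) && (t <= v) -> t <= v by case/andP.
case: (ex_maxnP ex bd) => t /andP[tC tv] tmax.
by exists t; split=> // d dC dv; apply: tmax; rewrite dC.
Qed.

(** Coins above [v] are skipped for both [v] and [v - t]. The first coin not above [v] is [t], and
    subtracting it once lowers its quotient by one. *)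
Lemma grd_dec_step cs v t :
  sorted gtn cs -> 0 < t -> largest_coin cs v t ->
  grd_dec cs v = (grd_dec cs (v - t)).+1.
Proof.
move=> + t0; elim: cs => [|c cs IH] /= cs_sorted [tC tv tmax]; first by [].
have [vc|cv] := ltnP v c.
  rewrite !divn_small ?modn_small ?(leq_ltn_trans (leq_subr _ _)) // !add0n.
  apply: IH; first exact: path_sorted cs_sorted.
  split=> // [|d dC]; last by apply: tmax; rewrite inE dC orbT.
  by move: tC; rewrite inE => /predU1P[tc|//]; lia.
have tc : t = c.
  apply/eqP; rewrite eqn_leq (tmax c) ?mem_head // andbT.
  move: tC; rewrite inE => /predU1P[->//|tC].
  have /allP/(_ _ tC) := order_path_min (rev_trans ltn_trans) cs_sorted.
  by rewrite /= => /ltnW.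
rewrite tc in t0 tv *; rewrite -{1 2}(subnK tv) modnDr.
by rewrite divnDr ?dvdnn // divnn t0 addn1.
Qed.

Lemma system_sorted C : is_system C -> sorted ltn C.
Proof. by case/andP. Qed.

Lemma system_one C : is_system C -> 1 \in C.
Proof. by case/andP; case: C => //= c C /eqP->; rewrite mem_head. Qed.

Lemma system_pos C c : is_system C -> c \in C -> 0 < c.
Proof.
case/andP; case: C => //= a C /eqP-> C_sorted; rewrite inE => /predU1P[->//|cC].
have /allP/(_ _ cC) := order_path_min ltn_trans C_sorted.
by move=> /= /ltnW.
Qed.

Lemma grd_step C v t :
  is_system C -> largest_coin C v t -> grd C v = (grd C (v - t)).+1.
Proof.
move=> sC [tC tv tmax]; apply: grd_dec_step.
- by rewrite rev_sorted; exact: system_sorted.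
- exact: system_pos tC.
- by split=> [||c]; rewrite ?mem_rev // => cC; apply: tmax.
Qed.

Lemma grd0 C : grd C 0 = 0.
Proof. by rewrite /grd; elim: (rev C) => //= c cs; rewrite div0n mod0n. Qed.

Lemma grd_rcons_lt C c v : v < c -> grd (rcons C c) v = grd C v.
Proof. by move=> vc; rewrite /grd rev_rcons /= divn_small ?modn_small. Qed.

Lemma grd_coin C c : is_system C -> c \in C -> grd C c = 1.
Proof.
by move=> sC cC; rewrite (@grd_step _ _ c) ?subnn ?grd0 //; split.
Qed.

Lemma grd_change C v : is_system C ->
  exists s, [/\ {subset s <= C}, sumn s = v & size s = grd C v].
Proof.
move=> sC; elim/ltn_ind: v => -[|v] IH; first by exists [::]; rewrite grd0.
have [t tP] := largest_coin_ex (system_one sC) (ltn0Sn v).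
have [tC tv _] := tP; have t0 := system_pos sC tC.
have [|s [ssub ssum ssize]] := IH (v.+1 - t); first by lia.
exists (t :: s); split=> /=; last by rewrite (grd_step sC tP) ssize.
  by move=> c; rewrite inE => /predU1P[->|/ssub].
by lia.
Qed.

Lemma grd_le1 C v : is_system C -> grd C v <= 1 -> v = 0 \/ v \in C.
Proof.
move=> sC; have [s [ssub <- <-]] := grd_change v sC.
case: s ssub => [|c [|//]] ssub _; first by left.
by right; rewrite /= addn0; apply: ssub; rewrite mem_head.
Qed.

(** * Change as a list of coins and as a vector of multiplicities *)

(** Taking [F] constantly 1 counts the coins of [s]; taking [F] the identity gives their total
    value. *)
Lemma sum_count_mem (C s : seq nat) (F : nat -> nat) :
  uniq C -> {subset s <= C} ->
  \sum_(c <- C) F c * count_mem c s = \sum_(a <- s) F a.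
Proof.
move=> uC; elim: s => [|a s IH] ssub /=.
  by rewrite big_nil big1 // => c _; rewrite muln0.
rewrite big_cons -IH => [|c cs]; last by apply: ssub; rewrite inE cs orbT.
under eq_bigr do rewrite mulnDr.
rewrite big_split /= (bigD1_seq a) ?ssub ?mem_head //= eqxx muln1.
by rewrite [X in _ + X + _]big1 ?addn0 // => c; rewrite eq_sym => /negPf->; rewrite muln0.
Qed.

Lemma represents_seq C x v : represents C x v ->
  exists s, [/\ {subset s <= C}, sumn s = v & size s = sumn x].
Proof.
case; elim: C x v => [|c C IH] [|n x] v //=.
  by move=> _ <-; exists [::]; rewrite /coin_value big_ord0.
case=> xC; rewrite /coin_value big_ord_recl /= => <-.
have [s [ssub ssum ssize]] := IH x _ xC erefl.
exists (nseq n c ++ s); split.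
- move=> d; rewrite mem_cat mem_nseq inE => /orP[/andP[_ ->]//|/ssub->].
  by rewrite orbT.
- by rewrite sumn_cat sumn_nseq ssum.
- by rewrite size_cat size_nseq ssize.
Qed.

Lemma seq_represents C s : uniq C -> {subset s <= C} ->
  exists2 x, represents C x (sumn s) & sumn x = size s.
Proof.
move=> uC ssub; exists [seq count_mem c s | c <- C]; last first.
  rewrite sumnE big_map -sum1_size -(sum_count_mem (fun=> 1) uC ssub).
  by apply: eq_bigr => c _; rewrite mul1n.
split; first by rewrite size_map.
rewrite sumnE -(sum_count_mem id uC ssub) (big_nth 0) big_mkord.
by apply: eq_bigr => i _; rewrite (nth_map 0).
Qed.

(** Induction on the number of coins: a change shorter than greedy is either optimal, giving a
    counterexample, or beaten by a still shorter change. *)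
Lemma canonical_grd_le C s : is_system C -> canonical C ->
  {subset s <= C} -> grd C (sumn s) <= size s.
Proof.
move=> sC canC ssub.
have uC : uniq C := sorted_uniq ltn_trans ltnn (system_sorted sC).
have [x + <-] := seq_represents uC ssub; move: (sumn s) => v {s ssub}.
have [k] := ubnP (sumn x); elim: k x => // k IH x /ltnSE-xk xP.
rewrite leqNgt; apply/negP => lt_x.
apply: (canC v); split; first by rewrite lt0n; apply: contraTneq lt_x => ->; rewrite grd0.
exists (sumn x); split=> //; split=> [|y yP]; first by exists x.
by rewrite leqNgt; apply/negP => lt_y; have := IH y (leq_trans lt_y xk) yP; lia.
Qed.

(** * Minimal counterexamples *)

Definition beats (C : seq nat) (w : nat) (s : seq nat) : Prop :=
  [/\ {subset s <= C}, sumn s = w & size s < grd C w].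

Definition minimal_counterexample (C : seq nat) (w : nat) : Prop :=
  (exists s, beats C w s) /\ forall v s, beats C v s -> w <= v.

Lemma noncanonical_minimal C : ~ canonical C ->
  exists w, minimal_counterexample C w.
Proof.
move=> ncan; apply: NNPP => nmin; apply: ncan => w [_ [k [[[x [xP xk]] _] kw]]].
have [s [ssub ssum ssize]] := represents_seq xP.
have: beats C w s by split=> //; rewrite ssize; exact: leq_ltn_trans xk kw.
elim/ltn_ind: w s {k x xP xk kw ssub ssum ssize} => w IH s sP.
apply: nmin; exists w; split=> [|v u uP]; first by exists s.
by rewrite leqNgt; apply/negP => vw; apply: IH vw u uP.
Qed.

Lemma minimal_grd_le C w s : minimal_counterexample C w ->
  {subset s <= C} -> sumn s < w -> grd C (sumn s) <= size s.
Proof.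
case=> _ wmin ssub ltw; rewrite leqNgt; apply/negP => lts.
by have := wmin (sumn s) s (And3 ssub erefl lts); lia.
Qed.

(** Dropping [c] from [s] leaves a change of [w - c], and no change of this smaller value beats
    greedy. *)
Lemma minimal_grd_subn_le C w s c :
  is_system C -> minimal_counterexample C w -> beats C w s -> c \in s ->
  c <= w /\ grd C (w - c) < size s.
Proof.
move=> sC wP [ssub ssum ssize] cs; have c0 := system_pos sC (ssub _ cs).
have ps := perm_to_rem cs.
have sum_s : w = c + sumn (rem c s) by rewrite -ssum (perm_sumn ps).
have size_s := perm_size ps; split; first by lia.
rewrite size_s sum_s addKn /= ltnS; apply: (minimal_grd_le wP); last by lia.
by move=> d /mem_rem/ssub.
Qed.

(* Otherwise the greedy change of [w - c] would use [t], so that [w] would have an optimal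
   change using [t], and [w - t] would be a smaller counterexample. *)
Lemma beats_coin_lt C w s c t :
  is_system C -> minimal_counterexample C w -> beats C w s -> c \in s ->
  t \in C -> (forall d, d \in C -> d <= t) -> t <= w -> c < t /\ w < c + t.
Proof.
move=> sC wP sP cs tC tmax tw.
have [cw grd_c] := minimal_grd_subn_le sC wP sP cs.
have [ssub ssum ssize] := sP; have cC := ssub _ cs.
have top v : t <= v -> largest_coin C v t by move=> tv; split=> // d /tmax.
have t0 := system_pos sC tC; have c0 := system_pos sC cC.
have grd_w := grd_step sC (top _ tw).
split.
  (* If [c = t], then [grd C w = (grd C (w - t)).+1 <= size s], so [s] would not beat greedy. *)
  have := tmax _ cC; rewrite leq_eqVlt => /predU1P[ct|//].
  by move: grd_c; rewrite ct; lia.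
rewrite ltnNge; apply/negP => ctw.
have [u [usub usum usize]] := grd_change (w - c - t) sC.
have gc := grd_step sC (top (w - c) _).
have: grd C (sumn (c :: u)) <= size (c :: u).
  apply: (minimal_grd_le wP) => /= [d|]; last by lia.
  by rewrite inE => /predU1P[->|/usub].
have -> : sumn (c :: u) = w - t by rewrite /= usum; lia.
by rewrite /= usize; have := gc ltac:(lia); lia.
Qed.

(** Keep [c] and change [w - c] greedily: this takes [t] first and needs no more coins than the rest
    of [s]. *)
Lemma beats_exchange C w s c t :
  is_system C -> minimal_counterexample C w -> beats C w s -> c \in s ->
  largest_coin C (w - c) t -> exists u, beats C w [:: c, t & u].
Proof.
move=> sC wP sP cs tP; have [cw grd_c] := minimal_grd_subn_le sC wP sP cs.
have [ssub _ ssize] := sP; have [tC tw _] := tP.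
have [u [usub usum usize]] := grd_change (w - c - t) sC.
have gt := grd_step sC tP; exists u; split=> /=.
- by move=> d; rewrite !inE => /or3P[/eqP->|/eqP->|/usub//]; [exact: ssub|].
- by rewrite usum; lia.
- by rewrite usize; lia.
Qed.

(** * Sums of two coins in a canonical system *)

(** Greedy spends at most two coins on [a + b]. The first is [t], so at most one coin is left. *)
Lemma canonical_pair C a b t : is_system C -> canonical C ->
  a \in C -> b \in C -> largest_coin C (a + b) t ->
  a + b - t = 0 \/ a + b - t \in C.
Proof.
move=> sC canC aC bC tP; apply: grd_le1 => //.
have: grd C (sumn [:: a; b]) <= 2.
  by apply: canonical_grd_le => // d; rewrite !inE => /orP[]/eqP->.
by rewrite /= addn0 (grd_step sC tP).
Qed.

Lemma canonical_pair6 c2 c3 c4 c5 c6 a b t (C := [:: 1; c2; c3; c4; c5; c6]) :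
  is_system C -> canonical C -> a \in C -> b \in C -> t \in C ->
  t <= a + b -> (forall d : nat, d \in C -> d <= t \/ a + b < d) ->
  a + b = t \/ a + b = t + 1 \/ a + b = t + c2 \/ a + b = t + c3 \/
  a + b = t + c4 \/ a + b = t + c5 \/ a + b = t + c6.
Proof.
move=> sC canC aC bC tC tv tmax.
have tP : largest_coin C (a + b) t by split=> // d /tmax; lia.
by have := canonical_pair sC canC aC bC tP; rewrite /C !inE; lia.
Qed.

(* In the next two lemmas the first disjunctions list how greedy can change [c_i + c5] with two
   coins, and [w - c5 \notin _] says that it changes [w] with at least three. *)
Lemma pair_sums_c2 c2 c3 c4 c5 c6 w :
  [&& 1 < c2, c2 < c3, c3 < c4, c4 < c5, c5 < c6 & c6 <= w] ->
  c2 + c5 < c6 \/ c2 + c5 = c6 \/ c2 + c5 = c6 + 1 ->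
  c3 + c5 < c6 \/ c3 + c5 = c6 \/ c3 + c5 = c6 + 1 \/ c3 + c5 = c6 + c2 ->
  c4 + c5 = c6 + 1 \/ c4 + c5 = c6 + c2 \/ c4 + c5 = c6 + c3 ->
  c5 + c5 = c6 + c2 \/ c5 + c5 = c6 + c3 \/ c5 + c5 = c6 + c4 ->
  w - c5 \notin [:: 1; c2; c3; c4; c5] -> w < c2 + c5 ->
  c2 + c4 < w /\ c5 <= c2 + c4.
Proof.
rewrite !inE => C_sorted sum2 sum3 sum4 sum5 not_coin w_lt.
by case: sum2; case: sum4; case: sum5; lia.
Qed.

Lemma pair_sums_c3 c2 c3 c4 c5 c6 w :
  [&& 1 < c2, c2 < c3, c3 < c4, c4 < c5, c5 < c6 & c6 <= w] ->
  c2 + c5 < c6 \/ c2 + c5 = c6 \/ c2 + c5 = c6 + 1 ->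
  c3 + c5 < c6 \/ c3 + c5 = c6 \/ c3 + c5 = c6 + 1 \/ c3 + c5 = c6 + c2 ->
  c4 + c5 = c6 + 1 \/ c4 + c5 = c6 + c2 \/ c4 + c5 = c6 + c3 ->
  c5 + c5 = c6 + c2 \/ c5 + c5 = c6 + c3 \/ c5 + c5 = c6 + c4 ->
  w - c5 \notin [:: 1; c2; c3; c4; c5] -> w < c3 + c5 ->
  [/\ w <> c3 + c4, w <> c3 + c3, c4 < c3 + c3 & c5 <= c3 + c4].
Proof.
rewrite !inE => C_sorted sum2 sum3 sum4 sum5 not_coin w_lt.
by split; case: sum3; case: sum4; case: sum5; lia.
Qed.

(** * Locating the least counterexample *)

Lemma minimal_counterexample_eq_double c2 c3 c4 c5 c6 w
    (C' := [:: 1; c2; c3; c4; c5]) (C := [:: 1; c2; c3; c4; c5; c6]) :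
  is_system C -> canonical C -> minimal_counterexample C' w ->
  [/\ c6 <= w, w = c4 + c4 & w - c5 \notin C'].
Proof.
move=> sC canC wP.
have C_sorted : [&& 1 < c2, c2 < c3, c3 < c4, c4 < c5 & c5 < c6].
  by move: sC; rewrite /is_system /= andbT.
have sC' : is_system C' by rewrite /is_system /=; lia.
have subC (d : nat) : d \in C' -> d \in C by rewrite !inE; lia.
have max_c5 (d : nat) : d \in C' -> d <= c5 by rewrite !inE; lia.
have c5C' : c5 \in C' by rewrite !inE eqxx !orbT.
(* Below [c6] greedy for [C] and for [C'] agree, so [w < c6] would contradict canonicity of [C]. *)
have c6w : c6 <= w.
  rewrite leqNgt; apply/negP => wc6; case: wP => -[s [ssub ssum ssize]] _.
  have := canonical_grd_le sC canC (fun d ds => subC d (ssub d ds)).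
  by rewrite ssum (_ : C = rcons C' c6) // grd_rcons_lt // leqNgt ssize.
have coin_lt s (d : nat) : beats C' w s -> d \in s -> d < c5 /\ w < d + c5.
  by move=> sP ds; apply: (beats_coin_lt sC' wP sP ds) => //; lia.
(* The coin 1 is excluded since [c5 < w]. *)
have coinP s (d : nat) : beats C' w s -> d \in s -> d = c2 \/ d = c3 \/ d = c4.
  move=> sP ds; have := coin_lt _ _ sP ds; case: sP => /(_ _ ds) + _ _.
  by rewrite !inE; lia.
have [[s sP] _] := wP.
(* Otherwise greedy changes [w] with two coins, while [s] has at least two because [w] exceeds every
   coin of [C']. *)
have not_coin : w - c5 \notin C'.
  have grd_w : grd C' w = (grd C' (w - c5)).+1.
    by apply: grd_step => //; split=> // [|d /max_c5]; lia.
  have size_s : 1 < size s.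
    case: sP => ssub ssum _; case: s ssub ssum => [|d [|//]] ssub /=; first by lia.
    by have := max_c5 d (ssub d (mem_head _ _)); lia.
  have [_ _ lt_s] := sP.
  by apply/negP => /(grd_coin sC'); lia.
have [d ds] : exists d : nat, d \in s.
  by case: sP => _; case: s => [|d s'] /=; [lia|exists d; exact: mem_head].
have wc45 : w < c4 + c5 by have := coin_lt s d sP ds; have := coinP s d sP ds; lia.
have exchange u (a : nat) : beats C' w u -> a \in u -> exists t u',
    [/\ beats C' w [:: a, t & u'], t <= w - a, c4 <= w - a -> c4 <= t &
        w = a + t \/ exists2 e : nat, e \in u' & a + t + e <= w].
  move=> uP au; have a_lt := coin_lt u a uP au.
  have [|t tP] := @largest_coin_ex C' (w - a) 1 (mem_head _ _); first by lia.
  have [u' u'P] := beats_exchange sC' wP uP au tP.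
  have [tC tw tmax] := tP; exists t, u'; split=> //.
  - by apply: tmax; rewrite !inE eqxx !orbT.
  - case: u'P => _ + _; case: u' => [|e u'] /= sum_w; first by left; lia.
    by right; exists e; [exact: mem_head|lia].
have over_c6 (a : nat) : a \in C' -> a + c5 < c6 \/ a + c5 = c6 \/
    a + c5 = c6 + 1 \/ a + c5 = c6 + c2 \/ a + c5 = c6 + c3 \/ a + c5 = c6 + c4.
  move=> aC; have [ac5|ac5] := ltnP (a + c5) c6; first by left.
  have ? := max_c5 a aC.
  have := @canonical_pair6 c2 c3 c4 c5 c6 a c5 c6 sC canC (subC _ aC) (subC _ c5C').
  rewrite !inE eqxx !orbT => /(_ isT ac5) h.
  by have := h ltac:(by move=> e; rewrite !inE; lia); lia.
have sum5 : c5 + c5 = c6 + c2 \/ c5 + c5 = c6 + c3 \/ c5 + c5 = c6 + c4.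
  by have := over_c6 c5 c5C'; lia.
have sum4 : c4 + c5 = c6 + 1 \/ c4 + c5 = c6 + c2 \/ c4 + c5 = c6 + c3.
  by have := over_c6 c4; rewrite !inE eqxx !orbT => /(_ isT); lia.
have sum2 : c2 + c5 < c6 \/ c2 + c5 = c6 \/ c2 + c5 = c6 + 1.
  by have := over_c6 c2; rewrite !inE eqxx !orbT => /(_ isT); lia.
have sum3 : c3 + c5 < c6 \/ c3 + c5 = c6 \/ c3 + c5 = c6 + 1 \/ c3 + c5 = c6 + c2.
  by have := over_c6 c3; rewrite !inE eqxx !orbT => /(_ isT); lia.
have w_c2 : w < c2 + c5 -> c2 + c4 < w /\ c5 <= c2 + c4.
  by apply: pair_sums_c2 sum2 sum3 sum4 sum5 not_coin; lia.
have w_c3 : w < c3 + c5 ->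
    [/\ w <> c3 + c4, w <> c3 + c3, c4 < c3 + c3 & c5 <= c3 + c4].
  by apply: pair_sums_c3 sum2 sum3 sum4 sum5 not_coin; lia.
(* Indeed [c5 + c5 <= c6 + c4 < c4 + c5 + c4]. *)
have c5_lt : c5 < c4 + c4 by lia.
clear sum2 sum3 sum4 sum5 over_c6.
(* By [w_c2] the coin after [c2] is [c4] and does not complete [w]; a third coin [e] would give
   [c4 + e < c5 <= c2 + c4], hence [e < c2]. *)
have no_c2 u : beats C' w u -> c2 \in u -> False.
  move=> uP c2u; have [t [u' [u'P tw t4 wE]]] := exchange u c2 uP c2u.
  have [_ c2_lt] := coin_lt u c2 uP c2u; have [c24w c24] := w_c2 c2_lt.
  have tE : t = c2 \/ t = c3 \/ t = c4 by apply: (coinP _ _ u'P); rewrite !inE eqxx orbT.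
  case: wE => [wE|[e eu' ew]]; first by lia.
  have eE : e = c2 \/ e = c3 \/ e = c4 by apply: (coinP _ _ u'P); rewrite !inE eu' !orbT.
  by lia.
have {}coinP u (e : nat) : beats C' w u -> e \in u -> e = c3 \/ e = c4.
  move=> uP eu; have [e2|//] := coinP u e uP eu.
  by case: (no_c2 u uP); rewrite -e2.
(* By [w_c3] two coins do not suffice. A third coin makes [w >= 3 * c3], so [c4 < w - c3] forces
   [t = c4], and then [w >= c3 + c4 + c3 >= c3 + c5]. *)
have no_c3 u : beats C' w u -> c3 \in u -> False.
  move=> uP c3u; have [t [u' [u'P tw t4 wE]]] := exchange u c3 uP c3u.
  have [_ c3_lt] := coin_lt u c3 uP c3u; have [w34 w33 c33 c34] := w_c3 c3_lt.
  have tE : t = c3 \/ t = c4 by apply: (coinP _ _ u'P); rewrite !inE eqxx orbT.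
  case: wE => [wE|[e eu' ew]]; first by lia.
  have eE : e = c3 \/ e = c4 by apply: (coinP _ _ u'P); rewrite !inE eu' !orbT.
  by lia.
have {no_c2 no_c3}coinP u (e : nat) : beats C' w u -> e \in u -> e = c4.
  move=> uP eu; have [e3|//] := coinP u e uP eu.
  by case: (no_c3 u uP); rewrite -e3.
have dE := coinP s d sP ds.
have [t [u [uP tw _ wE]]] := exchange s d sP ds.
have tE : t = c4 by apply: (coinP _ _ uP); rewrite !inE eqxx orbT.
case: wE => [wE|[e eu ew]]; first by split=> //; lia.
(* Three coins [c4] are too many, since [w < c4 + c5] and [c5 < c4 + c4]. *)
have eE : e = c4 by apply: (coinP _ _ uP); rewrite !inE eu !orbT.
by lia.
Qed.

(** * The three families *)

Lemma canonical_noncanonical_cases c2 c3 c4 c5 c6 :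
  is_system [:: 1; c2; c3; c4; c5; c6] -> canonical [:: 1; c2; c3; c4; c5; c6] ->
  ~ canonical [:: 1; c2; c3; c4; c5] ->
  [\/ [/\ c2 = 2, c3 = 3, c5 = c4 + 1, c6 = 2 * c4 & 4 < c4],
      [/\ c3 = 2 * c2 - 1, c5 = c2 + c4 - 1, c6 = 2 * c4 - 1 & 3 * c2 - 1 <= c4]
    | [/\ c3 = 2 * c2, c5 = c2 + c4, c6 = 2 * c4, 3 * c2 - 1 <= c4 & c4 <> 3 * c2]].
Proof.
move=> sC canC ncan; have [w wP] := noncanonical_minimal ncan.
have [] := minimal_counterexample_eq_double sC canC wP => + wE.
rewrite {}wE => {wP} c6w not_coin.
have C_sorted : [&& 1 < c2, c2 < c3, c3 < c4, c4 < c5 & c5 < c6].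
  by move: sC; rewrite /is_system /= andbT.
have pair (a b t : nat) := @canonical_pair6 c2 c3 c4 c5 c6 a b t sC canC.
have ne2 : c4 + c4 <> c5 + c2.
  by move=> e; move: not_coin; rewrite e addKn !inE eqxx !orbT.
have ne3 : c4 + c4 <> c5 + c3.
  by move=> e; move: not_coin; rewrite e addKn !inE eqxx !orbT.
clear not_coin.
have sum45 : c4 + c5 = c6 + 1 \/ c4 + c5 = c6 + c2 \/ c4 + c5 = c6 + c3.
  have := pair c4 c5 c6; rewrite !inE !eqxx !orbT => /(_ isT isT isT ltac:(lia)) h.
  by have := h ltac:(by move=> e; rewrite !inE; lia); lia.
have sum44 : c4 + c4 = c6 \/ c4 + c4 = c6 + 1 \/ c4 + c4 = c6 + c2.
  have := pair c4 c4 c6; rewrite !inE !eqxx !orbT => /(_ isT isT isT c6w) h.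
  by have := h ltac:(by move=> e; rewrite !inE; lia); lia.
have sum55 : c5 + c5 = c6 + c2 \/ c5 + c5 = c6 + c3 \/ c5 + c5 = c6 + c4.
  have := pair c5 c5 c6; rewrite !inE !eqxx !orbT => /(_ isT isT isT ltac:(lia)) h.
  by have := h ltac:(by move=> e; rewrite !inE; lia); lia.
(* The remainders of [c4 + c4], [c4 + c5], [c5 + c5] modulo [c6] form an arithmetic progression
   [p < q < r] of difference [c5 - c4]. If [r = c4], then [c4 + c4 = c5 + q], against [ne2] or [ne3]
   unless [q = 1], which would make [c4 <= 2]. This leaves [(0, 1, c2)], [(1, c2, c3)] and
   [(0, c2, c3)]. *)
have {sum44 sum45 sum55} : (c2 = 2 /\ c5 = c4 + 1 /\ c6 = 2 * c4) \/
    (c3 = 2 * c2 - 1 /\ c5 = c2 + c4 - 1 /\ c6 = 2 * c4 - 1) \/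
    (c3 = 2 * c2 /\ c5 = c2 + c4 /\ c6 = 2 * c4).
  case: sum45 => [|[]] sum45; case: sum44 => [|[]] sum44; case: sum55 => [|[]] sum55;
    solve [exfalso; lia | left; lia | right; left; lia | right; right; lia].
case=> [[e2 [e5 e6]]|[[e3 [e5 e6]]|[e3 [e5 e6]]]].
- have : c3 + c4 = c5 + 1 \/ c3 + c4 = c5 + c2.
    have := pair c3 c4 c5; rewrite !inE !eqxx !orbT => /(_ isT isT isT ltac:(lia)) h.
    by have := h ltac:(by move=> e; rewrite !inE; lia); lia.
  (* Here [c3 = 3], and [c4 = 4] would give [c4 + c4 = c5 + c3], against [ne3]. *)
  by move=> sum34; constructor 1; split; lia.
- constructor 2; split=> //; rewrite leqNgt; apply/negP => c4_lt.
  (* If [c4 = 2 * c2], then [c2 + c3] is the coin [c5] and yields nothing, so [c3 + c3] is used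
     instead. *)
  have [c4E|c4_ne] := eqVneq c4 (2 * c2).
    have := pair c3 c3 c5; rewrite !inE !eqxx !orbT => /(_ isT isT isT ltac:(lia)) h.
    by have := h ltac:(by move=> e; rewrite !inE; lia); lia.
  have := pair c2 c3 c4; rewrite !inE !eqxx !orbT => /(_ isT isT isT ltac:(lia)) h.
  by have := h ltac:(by move=> e; rewrite !inE; lia); lia.
- constructor 3; split=> //; [rewrite leqNgt; apply/negP => c4_lt | by lia].
  (* Greedy on [c2 + c3 = 3 * c2] would leave a remainder strictly between 1 and [c2] after taking
     [c4]. *)
  have := pair c2 c3 c4; rewrite !inE !eqxx !orbT => /(_ isT isT isT ltac:(lia)) h.
  by have := h ltac:(by move=> e; rewrite !inE; lia); lia.
Qed.

(** * The greedy count at [l * c3] *)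

(** After one coin [c5] less than [c3] remains, so only [c2] and 1 are used; each [c2] saves
    [c2 - 1] coins over paying in ones. *)
Lemma grd_between_c5_c6 c2 c3 c4 c5 c6 v :
  0 < c2 -> c3 <= c4 -> c4 <= c5 -> c5 <= v -> v < c6 -> v < c5 + c3 ->
  grd [:: 1; c2; c3; c4; c5; c6] v = v - c5 + 1 - (v - c5) %/ c2 * (c2 - 1).
Proof.
move=> c2_gt0 c34 c45 c5v vc6 vc53.
have mod_c5 : v %% c5 = v - c5 by rewrite -{1}(subnK c5v) modnDr modn_small //; lia.
have div_c5 : v %/ c5 = 1.
  by rewrite -{1}(subnK c5v) divnDr // divnn divn_small; lia.
rewrite /grd /= divn_small // modn_small // mod_c5 div_c5.
rewrite (@divn_small _ c4) ?(@modn_small _ c4) ?(@divn_small _ c3) ?(@modn_small _ c3); try lia.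
rewrite divn1; move: (v - c5) => d; rewrite mulnBr muln1.
(* The inequality keeps the truncated subtraction exact. *)
have := divn_eq d c2; have : d %/ c2 <= d %/ c2 * c2 by rewrite leq_pmulr.
move: (d %/ c2) (d %% c2) => q r.
by lia.
Qed.

Lemma ceil_mul_bounds m n (l := (m + n.-1) %/ n) :
  0 < n -> m <= l * n /\ l * n < m + n.
Proof.
move=> n_gt0; have := divn_eq (m + n.-1) n; have := ltn_pmod (m + n.-1) n_gt0.
by rewrite -/l; lia.
Qed.

Theorem theorem9 (c2 c3 c4 c5 c6 : nat) :
  is_system [:: 1; c2; c3; c4; c5; c6] ->
  canonical [:: 1; c2; c3; c4; c5; c6] ->
  ~ canonical [:: 1; c2; c3; c4; c5] ->
  let C := [:: 1; c2; c3; c4; c5; c6] in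
  let l := (c5 + c3.-1) %/ c3 in
  [\/ (c2 = 2 /\ c3 = 3 /\ c5 = c4 + 1 /\ c6 = 2 * c4 /\ 4 < c4),
      (c3 = 2 * c2 - 1 /\ c5 = c2 + c4 - 1 /\ c6 = 2 * c4 - 1 /\ 3 * c2 - 1 <= c4 /\
       grd C (l * c3) = l * c3 - c5 + 1 - ((l * c3 - c5) %/ c2) * (c2 - 1) /\
       grd C (l * c3) <= l)
    | (c3 = 2 * c2 /\ c5 = c2 + c4 /\ c6 = 2 * c4 /\ 3 * c2 - 1 <= c4 /\ c4 <> 3 * c2 /\
       grd C (l * c3) = l * c3 - c5 + 1 - ((l * c3 - c5) %/ c2) * (c2 - 1) /\
       grd C (l * c3) <= l)].
Proof.
move=> sC canC ncan C l.
have C_sorted : [&& 1 < c2, c2 < c3, c3 < c4, c4 < c5 & c5 < c6].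
  by move: sC; rewrite /is_system /= andbT.
have grd_le : grd C (l * c3) <= l.
  have: grd C (sumn (nseq l c3)) <= size (nseq l c3).
    apply: canonical_grd_le => // d; rewrite mem_nseq => /andP[_ /eqP->].
    by rewrite !inE eqxx !orbT.
  by rewrite sumn_nseq size_nseq mulnC.
have [|ge_c5 lt_c53] := @ceil_mul_bounds c5 c3; first by lia.
rewrite -/l in ge_c5 lt_c53.
have grdE : l * c3 < c6 ->
    grd C (l * c3) = l * c3 - c5 + 1 - (l * c3 - c5) %/ c2 * (c2 - 1).
  by move=> lt_c6; apply: grd_between_c5_c6 => //; lia.
have [] := canonical_noncanonical_cases sC canC ncan.
- by case=> *; constructor 1.
(* Here [c5 + c3 = c4 + 3 * c2 - 2 <= c6], so [l * c3 < c6]. *)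
- case=> e3 e5 e6 c4_ge; constructor 2; do ![split=> //]; apply: grdE; lia.
- case=> e3 e5 e6 c4_ge c4_ne; constructor 3; do ![split=> //]; apply: grdE.
  (* If [c4 = 3 * c2 - 1], the bound [l * c3 < c5 + c3] only gives [l * c3 <= c6]. *)
  suff : l * c2 <> 3 * c2 - 1 by lia.
  (* As [c2 > 1], [3 * c2 - 1] lies strictly between the multiples [2 * c2] and [3 * c2]. *)
  have [l3|l3] := ltnP l 3.
    by have := leq_mul2r c2 l 2; lia.
  by have := leq_mul2r c2 3 l; lia.
Qed.
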